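(* Let $R$ be a finite commutative ring with identity. Suppose that at least one primary component of $R$ is a local ring. Then each quasiprimitive S-ring $\mathcal A$ over the ring $R$ is either of rank $2$ or cyclotomic. In the latter case $R$ is a field.
   Context: S-rings. Let $G$ be a finite group. For $X\subseteq G$ put $\xi(X)=\sum_{x\in X}x\in\mathbb Z[G]$. A subring $\mathcal A$ of the group ring $\mathbb Z[G]$ is an S-ring (Schur ring) over $G$ if it has a $\mathbb Z$-basis $\{\xi(X): X\in\mathcal S\}$, where $\mathcal S=\mathcal S(\mathcal A)$ is a family of pairwise disjoint nonempty subsets of $G$ with $\{1\}\in\mathcal S$ (here $1$ is the identity element of $G$), $\bigcup_{X\in\mathcal S}X=G$, and $X\in\mathcal S\Rightarrow X^{-1}\in\mathcal S$. The elements of $\mathcal S$ are the basic sets of $\mathcal A$. The rank of $\mathcal A$ is $\mathrm{rk}(\mathcal A)=\dim_{\mathbb Z}(\mathcal A)=|\mathcal S|$. A subgroup of $G$ is an $\mathcal A$-subgroup if it is a union of basic sets. For $K\le\mathrm{Aut}(G)$, the S-ring $\mathcal A$ is $K$-invariant if $\mathcal A^k=\mathcal A$ for every $k\in K$, where $\mathrm{Aut}(G)$ acts on $\mathbb Z[G]$ by linear extension (equivalently, each $k\in K$ permutes the basic sets; the individual basic sets need not be fixed). $\mathcal A$ is $K$-primitive if the identity subgroup and $G$ are the only $K$-invariant $\mathcal A$-subgroups of $G$. S-rings over rings. Let $R$ be a finite commutative ring with identity, with additive group $R^+$ and unit group $R^\times$. Let $K_R\le\mathrm{Aut}(R^+)$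 be the group of all maps $x\mapsto ux$, $u\in R^\times$. An S-ring over the ring $R$ is a $K_R$-invariant S-ring over the group $R^+$. It is quasiprimitive if it is $K_R$-primitive. It is cyclotomic if for some subgroup $K\le K_R$ it consists of all $K$-invariant (fixed by every element of $K$) elements of $\mathbb Z[R^+]$; equivalently, its basic sets are exactly the orbits of $K$ on $R$. Primary components. $R=\prod_p R_p$, where $p$ runs over the prime divisors of $|R|$ and the primary component $R_p$ is the subring of $R$ (a ring with its own identity) whose additive group is the Sylow $p$-subgroup of $R^+$. A ring is local if its non-units form an ideal. *)

(* Defs.v *)
From HB Require Import structures.
From mathcomp Require Import all_boot all_order all_fingroup all_algebra.
From mathcomp Require Import all_solvable.

Set Implicit Arguments.
Unset Strict Implicit.
Unset Printing Implicit Defensive.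

Import GroupScope GRing.Theory.
Local Open Scope ring_scope.

(* The integral group ring Z[gT]: an element is its family of coefficients.
   A fresh name is needed because {ffun gT -> int} itself carries the
   pointwise product. *)
Definition group_ring (gT : finGroupType) : Type := {ffun gT -> int}.

Section GroupRing.
Variable gT : finGroupType.
Local Notation ZG := (group_ring gT).

HB.instance Definition _ := GRing.Zmodule.copy ZG {ffun gT -> int}.

Definition coefg (a : ZG) (x : gT) : int := (a : {ffun gT -> int}) x.

Definition grelt (x : gT) : ZG := [ffun y => (y == x)%:R : int].

Definition grmul (a b : ZG) : ZG :=
  [ffun x => \sum_(y : gT) coefg a y * coefg b (y^-1 * x)%g : int].

Lemma group_ringP (a b : ZG) : coefg a =1 coefg b -> a = b.
Proof. by move=> eq_ab; apply/ffunP. Qed.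

Lemma grmulE a b x :
  coefg (grmul a b) x = \sum_(y : gT) coefg a y * coefg b (y^-1 * x)%g.
Proof. by rewrite /coefg ffunE. Qed.

Lemma greltE x y : coefg (grelt x) y = (y == x)%:R.
Proof. by rewrite /coefg ffunE. Qed.

Lemma coefgD a b x : coefg (a + b) x = coefg a x + coefg b x.
Proof. by rewrite /coefg ffunE. Qed.

Fact grmulA : associative grmul.
Proof.
move=> a b c; apply: group_ringP => x; rewrite !grmulE.
under eq_bigr => y _ do rewrite grmulE big_distrr /=.
under [RHS]eq_bigr => y _ do rewrite grmulE big_distrl /=.
rewrite [RHS]exchange_big /=; apply: eq_bigr => y _.
rewrite [RHS](reindex_inj (mulgI y)) /=; apply: eq_bigr => z _.
by rewrite mulrA mulKg invMg mulgA.
Qed.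

Fact grmul1 : left_id (grelt 1%g) grmul.
Proof.
move=> a; apply: group_ringP => x; rewrite grmulE (bigD1 1%g) //= big1 => [|y].
  by rewrite greltE eqxx mul1r addr0 invg1 mul1g.
by rewrite greltE => /negPf->; rewrite mul0r.
Qed.

Fact grmulr1 : right_id (grelt 1%g) grmul.
Proof.
move=> a; apply: group_ringP => x; rewrite grmulE (bigD1 x) //= big1 => [|y].
  by rewrite greltE mulVg eqxx mulr1 addr0.
by rewrite greltE -eq_mulVg1 => /negPf->; rewrite mulr0.
Qed.

Fact grmulDl : left_distributive grmul +%R.
Proof.
move=> a b c; apply: group_ringP => x; rewrite coefgD !grmulE -big_split /=.
by apply: eq_bigr => y _; rewrite coefgD mulrDl.
Qed.

Fact grmulDr : right_distributive grmul +%R.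
Proof.
move=> a b c; apply: group_ringP => x; rewrite coefgD !grmulE -big_split /=.
by apply: eq_bigr => y _; rewrite coefgD mulrDr.
Qed.

Fact grelt1_neq0 : grelt 1%g != 0 :> ZG.
Proof.
apply/eqP => /(congr1 (coefg^~ 1%g)).
by rewrite greltE eqxx /coefg ffunE.
Qed.

HB.instance Definition _ := GRing.Zmodule_isNzRing.Build ZG
  grmulA grmul1 grmulr1 grmulDl grmulDr grelt1_neq0.

Lemma grelt1 : grelt 1%g = 1 :> ZG. Proof. by []. Qed.

Lemma greltM x y : grelt (x * y)%g = grelt x * grelt y :> ZG.
Proof.
apply: group_ringP => z; rewrite grmulE (bigD1 x) //= big1 => [|t].
  by rewrite !greltE eqxx mul1r addr0 -(inj_eq (mulgI x^-1)%g) mulKg.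
by rewrite greltE => /negPf->; rewrite mul0r.
Qed.

Definition xi (X : {set gT}) : ZG := \sum_(x in X) grelt x.

(* The linear extension of a permutation of gT to Z[gT]. *)
Definition gract (k : {perm gT}) (a : ZG) : ZG :=
  \sum_(x : gT) grelt (k x) *~ coefg a x.

End GroupRing.

(* sr_span and sr_free together say that the xi X are a Z-basis of sr_mem;
   basic_sets is therefore determined by sr_mem. *)
Record Sring (gT : finGroupType) := MkSring {
  sr_mem :> {pred group_ring gT};
  basic_sets : {set {set gT}};
  sr_subring : subring_closed sr_mem;
  sr_partition : partition basic_sets [set: gT];
  sr_one : [set 1%g] \in basic_sets;
  sr_inv : forall X, X \in basic_sets -> X^-1%g \in basic_sets;
  sr_span : forall a : group_ring gT, a \in sr_mem <->
    exists c : {set gT} -> int, a = \sum_(X in basic_sets) xi X *~ c X;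
  sr_free : forall c : {set gT} -> int,
    \sum_(X in basic_sets) xi X *~ c X = 0 ->
    forall X, X \in basic_sets -> c X = 0
}.

Section SringTheory.
Variable gT : finGroupType.
Implicit Types (A : Sring gT) (K : {set {perm gT}}) (H : {group gT}).

(* The rank over Z, the xi X being a basis indexed by the basic sets. *)
Definition Srank A : nat := #|basic_sets A|.

Definition Asubgroup A H : Prop :=
  exists2 T : {set {set gT}}, T \subset basic_sets A & cover T = H.

Definition Kinvariant K A : Prop := forall k, k \in K ->
  forall b, b \in A <-> exists2 a, a \in A & b = gract k a.

Definition Kprimitive K A : Prop := forall H,
  Asubgroup A H -> (forall k, k \in K -> k @: H = H) ->
  H :=: 1%g \/ H :=: [set: gT].

End SringTheory.

(* R is used both as a ring and, through the library's additive group
   structure, as a finGroupType: 1%g is 0 and (x * y)%g is x + y. *)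
Section SringOverRing.
Variable R : finComUnitRingType.

Definition unit_mults : {group {perm R}} :=
  (actperm 'U @* [set: {unit R}])%G.

Lemma unit_multsP (s : {perm R}) :
  reflect (exists2 u : R, u \is a GRing.unit & forall x, s x = u * x)
          (s \in unit_mults).
Proof.
apply: (iffP idP) => [/morphimP[u _ _ ->]|[u Uu sE]].
  by exists (val u); [exact: (valP u) | move=> x; rewrite actpermE mulrC].
apply/morphimP; exists (FinRing.unit R Uu); rewrite ?inE //.
by apply/permP => x; rewrite actpermE sE mulrC.
Qed.

Lemma unit_mults_Aut : unit_mults \subset Aut [set: R].
Proof.
apply/subsetP => s /unit_multsP[u _ sE]; rewrite inE.
apply/andP; split; first by apply/subsetP => x; rewrite inE.
by apply/morphicP => x y _ _; rewrite !sE; apply: mulrDr.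
Qed.

Definition Sring_over (A : Sring R) : Prop := Kinvariant unit_mults A.

Definition quasiprimitive (A : Sring R) : Prop := Kprimitive unit_mults A.

Definition cyclotomic (A : Sring R) : Prop :=
  exists2 K : {group {perm R}}, K \subset unit_mults &
  forall a : group_ring R, a \in A <-> forall k, k \in K -> gract k a = a.

End SringOverRing.

Section PrimaryComponent.
Variables (R : finComUnitRingType) (p : nat).

Definition primary_set : {set R} := 'O_p([set: R]).

Lemma primary_set_Sylow : p.-Sylow([set: R]) primary_set.
Proof.
apply: nilpotent_pcore_Hall; apply: abelian_nil.
by apply/centsP => x _ y _; apply: addrC.
Qed.

Lemma primary_setE (x : R) : (x \in primary_set) = p.-elt (x : R).
Proof. by rewrite (mem_Hall_pcore primary_set_Sylow) ?inE. Qed.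

Lemma order_mulr_dvd (x y : R) : (#[(x * y)%R : R]%g %| #[x : R]%g)%N.
Proof.
rewrite order_dvdn; apply/eqP; rewrite FinRing.zmodXgE -mulrnAl.
by rewrite -FinRing.zmodXgE expg_order mul0r.
Qed.

Fact primary_set0 : 0 \in primary_set.
Proof. exact: (group1 'O_p([set: R])). Qed.

Fact primary_set_add (x y : R) :
  x \in primary_set -> y \in primary_set -> x + y \in primary_set.
Proof. exact: (@groupM R 'O_p([set: R])%G). Qed.

Fact primary_set_opp (x : R) : x \in primary_set -> - x \in primary_set.
Proof. exact: (@groupVr R 'O_p([set: R])%G). Qed.

Fact primary_set_mul (x y : R) : x \in primary_set -> x * y \in primary_set.
Proof. by rewrite !primary_setE; apply: pnat_dvd; apply: order_mulr_dvd. Qed.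

Fact primary_set_one : ((1%R : R).`_p)%g \in primary_set.
Proof. by rewrite primary_setE p_elt_constt. Qed.

Fact primary_set_mul1 (x : R) :
  x \in primary_set -> ((1%R : R).`_p)%g * x = x.
Proof.
rewrite primary_setE => px.
suff /eqP x0: ((1%R : R).`_p^')%g * x == 0.
  rewrite -[RHS]mul1r -[X in _ = X * _](consttC p (1%R : R)) [RHS]mulrDl.
  by rewrite x0 addr0.
rewrite -[_ == _]/(_ == 1%g) -order_eq1 -dvdn1.
have p'1: p^'.-nat #[((1%R : R).`_p^')%g]%g := p_elt_constt _ _.
rewrite -(eqP (pnat_coprime px p'1)) dvdn_gcd order_mulr_dvd andbT.
by rewrite mulrC order_mulr_dvd.
Qed.

(* R_p as a ring in its own right. It is not a subring of R in the sense of
   subring_closed: its identity is the p-part of 1. *)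
Record primary_component : Type := Primary {
  primary_val : R;
  primary_valP : primary_val \in primary_set
}.

HB.instance Definition _ := [isSub for primary_val].
HB.instance Definition _ := [Choice of primary_component by <:].

Definition primary_zero : primary_component := Primary primary_set0.
Definition primary_add (x y : primary_component) : primary_component :=
  Primary (primary_set_add (primary_valP x) (primary_valP y)).
Definition primary_opp (x : primary_component) : primary_component :=
  Primary (primary_set_opp (primary_valP x)).
Definition primary_one : primary_component := Primary primary_set_one.
Definition primary_mul (x y : primary_component) : primary_component :=
  Primary (primary_set_mul (primary_val y) (primary_valP x)).

Fact primary_addA : associative primary_add.
Proof. by move=> x y z; apply/val_inj/addrA. Qed.
Fact primary_addC : commutative primary_add.
Proof. by move=> x y; apply/val_inj/addrC. Qed.
Fact primary_add0 : left_id primary_zero primary_add.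
Proof. by move=> x; apply/val_inj/add0r. Qed.
Fact primary_addN : left_inverse primary_zero primary_opp primary_add.
Proof. by move=> x; apply/val_inj/addNr. Qed.

HB.instance Definition _ := GRing.isZmodule.Build primary_component
  primary_addA primary_addC primary_add0 primary_addN.

Fact primary_mulA : associative primary_mul.
Proof. by move=> x y z; apply/val_inj/mulrA. Qed.
Fact primary_mulC : commutative primary_mul.
Proof. by move=> x y; apply/val_inj/mulrC. Qed.
Fact primary_mul1 : left_id primary_one primary_mul.
Proof. by move=> x; apply/val_inj/(primary_set_mul1 (primary_valP x)). Qed.
Fact primary_mulDl : left_distributive primary_mul +%R.
Proof. by move=> x y z; apply/val_inj/mulrDl. Qed.

HB.instance Definition _ := GRing.Zmodule_isComPzRing.Build primary_component
  primary_mulA primary_mulC primary_mul1 primary_mulDl.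
End PrimaryComponent.

(* The library's GRing.unit and idealr_closed require 1 != 0, which the ring
   primary_component R p satisfies only when p divides #|R|. *)
Section LocalRing.
Variable S : comPzRingType.

Definition invertible (x : S) : Prop := exists y : S, x * y = 1.

Definition is_ideal (I : S -> Prop) : Prop :=
  [/\ I 0, forall x y, I x -> I y -> I (x + y)
    & forall a x, I x -> I (a * x)].

Definition local_ring : Prop := is_ideal (fun x => ~ invertible x).
End LocalRing.

(* Main.v *)
Require Import Defs.
From mathcomp Require Import all_boot all_order all_fingroup all_algebra.
From mathcomp Require Import all_solvable all_field all_character.
From mathcomp Require Import zify.
(* all_character redefines group_ring. *)
Import Defs.

(** Let R_p = eR be the local component, N a power of p with N = e' = 1 - e in
R, and H the ideal of all x with ex not invertible in eR. Call two additive
characters equivalent if their Fourier values agree on all functions that are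
constant on basic sets and unit-invariant; by Lagrange interpolation the sum f
of an equivalence class D is again such a function. Modulo p the value f(x)^N is
f(Nx) = f(e'x), so the level set of f^N at 0 is eR-periodic, hence everything by
quasiprimitivity; therefore p divides the number of characters in D that agree
on e'R with a given b <> 1 trivial on eR. A character l <> 1 trivial on H acts
freely on those other than b, unless b is equivalent to lb. So b and lb are
equivalent, and this forces invariant functions to be constant off H. Then the
units permute the nonzero basic sets transitively, and as an abelian group they
do so regularly: a unit fixing one x <> 0 fixes every basic set.
If e' <> 0, each unit is a product of one fixing e and one fixing e', so the
rank is 2. If e' = 0 and H <> 0, then 1 + H fixes all basic sets, and counting
differences within the basic set of 1 excludes rank > 2. If e' = 0 and H = 0, R
is a field and the basic sets are the orbits of the stabiliser of that set. *)

Set Implicit Arguments.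
Unset Strict Implicit.
Unset Printing Implicit Defensive.

Import GroupScope Order.TTheory GRing.Theory Num.Theory.

(** * Characters and Fourier transform *)

Section AdditiveCharacters.
Local Open Scope ring_scope.
Variable V : finZmodType.

Definition dual := Iirr [set: V].

Definition chr (i : dual) (x : V) : algC := 'chi_i x.

Lemma finZmod_abelian : abelian [set: V].
Proof. by apply/centsP => x _ y _; apply: addrC. Qed.

Lemma chr_lin (i : dual) : 'chi_i \is a linear_char.
Proof. exact/char_abelianP/finZmod_abelian. Qed.

Lemma chr0 i : chr i 0 = 1.
Proof. exact: (lin_char1 (chr_lin i)). Qed.

Lemma chrD i x y : chr i (x + y) = chr i x * chr i y.
Proof. by apply: (lin_charM (chr_lin i)); rewrite inE. Qed.

Lemma chrMn i x n : chr i (x *+ n) = chr i x ^+ n.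
Proof.
by elim: n => [|n IHn]; rewrite ?expr0 ?chr0 // mulrS chrD IHn exprS.
Qed.

Lemma chr_Aint i x : chr i x \in Aint.
Proof. exact: Aint_irr. Qed.

Lemma chr_nz i x : chr i x != 0.
Proof. by apply: (lin_char_neq0 (chr_lin i)); rewrite inE. Qed.

Lemma chr_inj i j : chr i =1 chr j -> i = j.
Proof. by move=> eqij; apply: irr_inj; apply/cfunP. Qed.

Lemma sum_dual x : \sum_i chr i x = (x == 0)%:R * #|V|%:R.
Proof.
have := second_orthogonality_relation x (in_setT (0 : V)).
rewrite (_ : 'C_[set: V][x] = [set: V]); last first.
  by apply/setP => y; rewrite inE in_setT; apply/cent1P; apply: addrC.
rewrite cardsT -[in X in _ = X]/(1%g : V) class1G inE mulrb.
rewrite mulr_natl mulrb => <-; apply: eq_bigr => i _.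
by rewrite -/(chr i _) -/(chr i _) chr0 conjC1 mulr1.
Qed.

Definition chr_mul (i j : dual) : dual := cfIirr ('chi_i * 'chi_j).

Lemma chr_mulE i j x : chr (chr_mul i j) x = chr i x * chr j x.
Proof.
by rewrite /chr cfIirrE ?cfunE // lin_char_irr // rpredM ?chr_lin.
Qed.

Lemma chr_mulI i : injective (chr_mul i).
Proof.
move=> j k eqjk; apply: chr_inj => x.
have /eqP := congr1 (chr^~ x) eqjk; rewrite !chr_mulE => /eqP.
by apply: mulfI; apply: chr_nz.
Qed.

Definition fourier (f : V -> algC) (i : dual) : algC := \sum_x f x * chr i x.

Definition conv (f g : V -> algC) (x : V) : algC := \sum_y f y * g (x - y).

Lemma fourier_inv f x :
  \sum_i fourier f i * chr i (- x) = #|V|%:R * f x.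
Proof.
under eq_bigr => i _ do rewrite mulr_suml.
rewrite exchange_big /= (bigD1 x) //= [X in _ + X]big1 ?addr0 => [|y ne_yx].
  under eq_bigr => i _ do rewrite -mulrA -chrD subrr.
  by rewrite -mulr_sumr sum_dual eqxx mul1r mulrC.
under eq_bigr => i _ do rewrite -mulrA -chrD.
by rewrite -mulr_sumr sum_dual subr_eq0 (negPf ne_yx) mul0r mulr0.
Qed.

Lemma fourier_conv f g i :
  fourier (conv f g) i = fourier f i * fourier g i.
Proof.
rewrite /fourier mulr_suml; under eq_bigr => x _ do rewrite mulr_suml.
rewrite exchange_big /=; apply: eq_bigr => y _.
rewrite mulr_sumr (reindex_inj (addrI y)) /=; apply: eq_bigr => x _.
by rewrite chrD [y + x]addrC addrK mulrACA.
Qed.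

Lemma fourierD f g i :
  fourier (fun x => f x + g x) i = fourier f i + fourier g i.
Proof. by rewrite -big_split; apply: eq_bigr => x _; rewrite mulrDl. Qed.

Lemma fourierZ c f i : fourier (fun x => c * f x) i = c * fourier f i.
Proof. by rewrite mulr_sumr; apply: eq_bigr => x _; rewrite mulrA. Qed.

Lemma fourier_delta i : fourier (fun x => (x == 0)%:R) i = 1.
Proof.
rewrite /fourier (bigD1 0) //= big1 ?addr0 ?eqxx ?chr0 ?mulr1 // => x.
by move/negPf->; rewrite mul0r.
Qed.

(** Shifting the summation variable by [d] multiplies the sum by [chr i d]. *)
Lemma fourier_periodic f i d :
  (forall x, f (d + x) = f x) -> chr i d != 1 -> fourier f i = 0.
Proof.
move=> f_d chi_d; apply/eqP.
have: fourier f i * (chr i d - 1) == 0.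
  rewrite mulrBr mulr1 {2}/fourier (reindex_inj (addrI d)) /= subr_eq0.
  rewrite mulr_suml; apply/eqP/eq_bigr => x _.
  by rewrite f_d chrD -!mulrA [chr i x * _]mulrC.
by rewrite mulf_eq0 subr_eq0 (negPf chi_d) orbF.
Qed.

Lemma fourier_const f : (forall i, i != 0 -> fourier f i = 0) ->
  forall x y, f x = f y.
Proof.
move=> f0; have V0: #|V|%:R != 0 :> algC by rewrite pnatr_eq0 -lt0n (cardD1 0).
suff fE x: #|V|%:R * f x = fourier f 0.
  by move=> x y; apply: (mulfI V0); rewrite !fE.
rewrite -fourier_inv (bigD1 0) //= big1 ?addr0 => [|i /f0->]; last first.
  by rewrite mul0r.
by rewrite /chr irr0 cfun1E inE mulr1.
Qed.

(** Otherwise every nontrivial character is nontrivial on [H], so all nontrivial Fourier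
    coefficients of the [H]-periodic indicator of [H] vanish and this indicator is constant. *)
Lemma dual_separates (H : {set V}) :
  (forall x y, x \in H -> y \in H -> x + y \in H) ->
  (forall x, x \in H -> - x \in H) -> 0 \in H -> H != setT ->
  exists2 i : dual, i != 0 & forall x, x \in H -> chr i x = 1.
Proof.
move=> HD HN H0 /eqP H'T; pose f x : algC := (x \in H)%:R.
case: (pickP (fun i : dual => (i != 0) && [forall x in H, chr i x == 1])).
  by move=> i /andP[i0 /forall_inP iH]; exists i => // x /iH/eqP.
move=> noi; case: H'T; apply/setP => x; rewrite inE.
suff /fourier_const/(_ x 0)/eqP : forall i, i != 0 -> fourier f i = 0.
  by rewrite /f H0 eqr_nat; case: (x \in H).
move=> i i0; have := noi i; rewrite i0 /= => /negbT.
rewrite negb_forall_in => /exists_inP[d Hd].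
apply: fourier_periodic => y; congr (_%:R); congr nat_of_bool.
by apply/idP/idP => [/(HD _ _ (HN d Hd))|/(HD _ _ Hd)] //; rewrite addKr.
Qed.

Lemma chr0E x : chr 0 x = 1.
Proof. by rewrite /chr irr0 cfun1E inE. Qed.

Lemma chr_neq0 (i : dual) : i != 0 -> exists x, chr i x != 1.
Proof.
move=> i0; apply/existsP; apply: contraR i0 => /existsPn i1.
by apply/eqP/chr_inj => x; rewrite chr0E; apply/eqP; move: (i1 x); rewrite negbK.
Qed.

End AdditiveCharacters.

(** * Functions constant on basic sets *)

Section GroupRingCoefficients.
Local Open Scope ring_scope.
Variable gT : finGroupType.
Implicit Types (a : group_ring gT) (x : gT).

Lemma coefg_sum I r (P : pred I) (F : I -> group_ring gT) x :
  coefg (\sum_(i <- r | P i) F i) x = \sum_(i <- r | P i) coefg (F i) x.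
Proof.
by elim/big_rec2: _ => [|i b a _ <-]; rewrite ?coefgD // /coefg ffunE.
Qed.

Lemma coefg_mulz a (z : int) x : coefg (a *~ z) x = coefg a x * z.
Proof.
have coefMn n : coefg (a *+ n) x = coefg a x *+ n.
  by elim: n => [|n IHn]; rewrite ?mulrS ?coefgD ?IHn // /coefg ffunE.
case: z => n; first by rewrite -pmulrn coefMn -mulr_natr natz.
rewrite NegzE mulrNz -pmulrn [LHS](_ : _ = - coefg (a *+ n.+1) x).
  by rewrite coefMn mulrN -mulr_natr natz.
by rewrite /coefg ffunE.
Qed.

Lemma coefg_xi (X : {set gT}) x : coefg (xi X) x = (x \in X)%:R.
Proof.
rewrite coefg_sum; under eq_bigr => y _ do rewrite greltE.
have [Xx | X'x] := boolP (x \in X).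
  by rewrite (bigD1 x) //= eqxx big1 ?addr0 // => y /andP[_ /negPf]; rewrite eq_sym => ->.
by rewrite big1 // => y Xy; case: eqP X'x => // ->; rewrite Xy.
Qed.

Lemma coefg_gract (k : {perm gT}) a x : coefg (gract k a) (k x) = coefg a x.
Proof.
rewrite coefg_sum (bigD1 x) //= coefg_mulz greltE eqxx mul1r.
rewrite big1 ?addr0 // => y ne_yx; rewrite coefg_mulz greltE.
by rewrite (inj_eq perm_inj) eq_sym (negPf ne_yx) mul0r.
Qed.

End GroupRingCoefficients.

Section BasicSets.
Local Open Scope ring_scope.
Variable gT : finGroupType.
Variable A : Sring gT.
Implicit Types x y : gT.

Definition blk x : {set gT} := pblock (basic_sets A) x.

Definition blockwise T (f : gT -> T) := forall x y, y \in blk x -> f y = f x.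

Lemma blk_basic x : blk x \in basic_sets A.
Proof. by rewrite pblock_mem // (cover_partition (sr_partition A)) inE. Qed.

Lemma mem_blk x : x \in blk x.
Proof. by rewrite mem_pblock (cover_partition (sr_partition A)) inE. Qed.

Lemma blk_def X x : X \in basic_sets A -> x \in X -> blk x = X.
Proof. exact: def_pblock (partition_trivIset (sr_partition A)). Qed.

Lemma blk_eq x y : (y \in blk x) = (blk y == blk x).
Proof.
apply/idP/eqP => [|<-]; last exact: mem_blk.
by apply: blk_def; apply: blk_basic.
Qed.

Lemma blk_sym x y : (y \in blk x) = (x \in blk y).
Proof. by rewrite !blk_eq eq_sym. Qed.

Lemma sum_blk (M : nmodType) (c : {set gT} -> M) x :
  \sum_(X in basic_sets A) c X *+ (x \in X) = c (blk x).
Proof.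
rewrite (bigD1 (blk x)) ?blk_basic //= mem_blk big1 ?addr0 // => X /andP[SX].
by case: (boolP (x \in X)) => // /(blk_def SX)->; rewrite eqxx.
Qed.

Lemma coefg_span (c : {set gT} -> int) x :
  coefg (\sum_(X in basic_sets A) xi X *~ c X) x = c (blk x).
Proof.
rewrite coefg_sum; under eq_bigr => X _ do rewrite coefg_mulz coefg_xi mulr_natl.
exact: sum_blk.
Qed.

Lemma sr_blockwise a : a \in sr_mem A <-> blockwise (coefg a).
Proof.
split=> [/sr_span[c ->] x y|aA].
  by rewrite blk_eq => /eqP eq_xy; rewrite !coefg_span eq_xy.
apply/sr_span; exists (fun X => coefg a (repr X)); apply: group_ringP => x.
by rewrite coefg_span (aA x) //; apply: mem_repr (mem_blk x).
Qed.

Lemma xi_sr X : X \in basic_sets A -> xi X \in sr_mem A.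
Proof.
move=> SX; apply/sr_blockwise => x y; rewrite blk_eq !coefg_xi => /eqP eqxy.
congr (_%:R); congr nat_of_bool; apply/idP/idP => Xz.
  by rewrite -(blk_def SX Xz) eqxy mem_blk.
by rewrite -(blk_def SX Xz) -eqxy mem_blk.
Qed.

End BasicSets.

(* The automatic scope of these arguments would read [u * x] as a sum. *)
Arguments blk : clear scopes.
Arguments mem_blk : clear scopes.
Arguments blk_basic : clear scopes.

(** * Invariant functions and quasiprimitivity *)

Section SringOverRingBlocks.
Local Open Scope ring_scope.
Variables (R : finComUnitRingType) (A : Sring R).
Local Notation blk := (@blk R A).
Local Notation blockwise := (@blockwise R A _).

(** The subring property concerns integer coefficients. Expanding [f] and [g] in indicators of basic
    sets makes [conv f g] a complex combination of the coefficient functions of the products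
    [xi X * xi Y], which lie in [A]. *)
Lemma blockwise_conv (f g : R -> algC) :
  blockwise f -> blockwise g -> blockwise (conv f g).
Proof.
move=> fA gA.
have expand (h : R -> algC) : blockwise h -> forall x,
    h x = \sum_(X in basic_sets A) h (repr X) *+ (x \in X).
  by move=> hA x; rewrite (sum_blk A (h \o repr)) /= (hA x) // (mem_repr _ (mem_blk A x)).
have convE x : conv f g x = \sum_(X in basic_sets A) \sum_(Y in basic_sets A)
    f (repr X) * g (repr Y) * (coefg (xi X * xi Y) x)%:~R.
  rewrite /conv; under eq_bigr => y _ do
    rewrite (expand f fA y) (expand g gA (x - y)) mulr_suml.
  rewrite exchange_big; apply: eq_bigr => X _ /=.
  under eq_bigr => y _ do rewrite mulr_sumr.
  rewrite exchange_big; apply: eq_bigr => Y _ /=.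
  rewrite [xi X * xi Y]/(grmul _ _) grmulE rmorph_sum mulr_sumr /=.
  apply: eq_bigr => y _; rewrite !coefg_xi rmorphM /= !rmorph_nat.
  rewrite -[_ *+ (y \in X)]mulr_natr -[_ *+ (_ \in Y)]mulr_natr mulrACA.
  by congr (_ * (_ * (_ \in Y)%:R)); apply: addrC.
move=> x y xy; rewrite !convE.
apply: eq_bigr => X SX; apply: eq_bigr => Y SY; congr (_ * _%:~R).
have [_ _ AM] := sr_subring A.
by move: x y xy; apply/sr_blockwise/AM; apply: xi_sr.
Qed.

Lemma blk0 : blk 0 = [set 0].
Proof. by apply: blk_def; [exact: sr_one | rewrite inE]. Qed.

Lemma blockwise_delta : blockwise (fun x => (x == 0)%:R : algC).
Proof.
move=> x y; rewrite blk_eq => /eqP eqxy; congr (_%:R); congr nat_of_bool.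
have E z : (z == 0) = (z \in blk 0) by rewrite blk0 inE.
by rewrite !E !blk_eq eqxy.
Qed.

Hypothesis hA : Sring_over A.

Lemma unit_mult_perm (u : R) : u \is a GRing.unit ->
  exists2 k, k \in unit_mults R & forall x, k x = u * x.
Proof.
move=> Uu; have kE := permE (mulrI Uu).
by exists (perm (mulrI Uu)) => //; apply/unit_multsP; exists u.
Qed.

Lemma blk_unit u x y : u \is a GRing.unit ->
  y \in blk x -> u * y \in blk (u * x).
Proof.
move=> /unit_mult_perm[k Kk kE] xy.
(* The indicator of the target block is pulled back along [k]; the result [a] lies in [A], so it
   takes equal values at [x] and [y]. *)
have [a aA eq_a] := (hA Kk (xi (blk (u * x)))).1 (xi_sr (blk_basic A _)).
have := (sr_blockwise A a).1 aA x y xy.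
rewrite -(coefg_gract k a x) -(coefg_gract k a y) -eq_a !coefg_xi !kE mem_blk => /eqP.
by rewrite eqr_nat; case: (_ \in _).
Qed.

Lemma blk_unit_eq u x y : u \is a GRing.unit ->
  (u * y \in blk (u * x)) = (y \in blk x).
Proof.
move=> Uu; apply/idP/idP; last exact: blk_unit.
by rewrite -{2}[y](mulKr Uu) -{2}[x](mulKr Uu); apply: blk_unit; rewrite unitrV.
Qed.

(** The target is left free: for [mem S] this says that [S] is a unit-stable union of basic sets,
    and with values in [algC] these functions form the convolution algebra under study. *)
Definition inv_function T (f : R -> T) :=
  blockwise f /\ forall u x, u \is a GRing.unit -> f (u * x) = f x.

Lemma inv_conv (f g : R -> algC) :
  inv_function f -> inv_function g -> inv_function (conv f g).
Proof.
move=> [fA fU] [gA gU]; split=> [|u x Uu]; first exact: blockwise_conv.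
rewrite /conv (reindex_inj (mulrI Uu)) /=; apply: eq_bigr => y _.
by rewrite -mulrBr fU ?gU.
Qed.

Lemma inv_delta : inv_function (fun x => (x == 0)%:R : algC).
Proof.
split=> [|u x Uu]; first exact: blockwise_delta.
by rewrite mulrI_eq0 //; apply: mulrI.
Qed.

Lemma inv_oppr T (f : R -> T) x : inv_function f -> f (- x) = f x.
Proof. by move=> [_ fU]; rewrite -mulN1r fU ?unitrN1. Qed.

Lemma inv_comp T U (h : T -> U) (f : R -> T) :
  inv_function f -> inv_function (h \o f).
Proof. by case=> fA fU; split=> [x y xy|u x Uu] /=; rewrite ?fU ?(fA x). Qed.

Hypothesis hprim : quasiprimitive A.

Lemma prim_subgroup (H : {set R}) :
  0 \in H -> (forall x y, x \in H -> y \in H -> x + y \in H) ->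
  inv_function (mem H) -> H = [set 0] \/ H = setT.
Proof.
move=> H0 HD [HA HU].
have gH : group_set H by apply/group_setP; split.
have := hprim (H := Group gH); apply=> [|k /unit_multsP[u Uu kE]] /=.
  exists [set X in basic_sets A | X \subset H].
    by apply/subsetP => X; rewrite inE => /andP[].
  apply/setP => x; apply/bigcupP/idP => [[X]|Hx].
    by rewrite inE => /andP[_ /subsetP]; apply.
  exists (blk x); rewrite ?mem_blk // inE blk_basic; apply/subsetP => y.
  by move/HA; rewrite /= Hx.
apply/eqP; rewrite eqEcard card_imset ?leqnn ?andbT; last exact: perm_inj.
by apply/subsetP => _ /imsetP[x Hx ->]; rewrite kE; have := HU u x Uu => /= ->.
Qed.

(* The radical [set y | S + y = S] of an invariant A-set S is an invariant
   A-subgroup, since the number of x with x and x + y in S is a convolution. *)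
Lemma periodic_setT (S : {set R}) d : inv_function (mem S) ->
  d != 0 -> (forall x, (d + x \in S) = (x \in S)) -> 0 \in S -> S = setT.
Proof.
move=> invS d0 Sd S0; pose rad := [set y | [forall x in S, x - y \in S]].
have radD x y : x \in rad -> y \in rad -> x + y \in rad.
  rewrite !inE => /forall_inP Sx /forall_inP Sy.
  by apply/forall_inP => z /Sx/Sy; rewrite opprD addrA.
have rad0 : 0 \in rad by rewrite inE; apply/forall_inP => x; rewrite subr0.
pose f x : algC := (x \in S)%:R.
have inv_f : inv_function f := inv_comp (fun b : bool => b%:R : algC) invS.
have radE y : (y \in rad) = (conv f f y == #|S|%:R).
  rewrite inE /conv.
  have -> : \sum_z f z * f (y - z) = #|[set x in S | x - y \in S]|%:R.
    rewrite -sum1_card natr_sum [RHS]big_mkcond /=; apply: eq_bigr => x _.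
    (* Since [-1] is a unit, [f] is even, and [y - x] may be replaced by [x - y]. *)
    rewrite inE -(inv_oppr (y - x) inv_f) opprB /f.
    by case: (x \in S); case: (_ \in S); rewrite ?mul1r ?mul0r ?mulr0.
  rewrite eqr_nat.
  have sub : [set x in S | x - y \in S] \subset S.
    by apply/subsetP => x; rewrite inE => /andP[].
  rewrite (eqn_leq #|_|) (subset_leq_card sub) /=.
  have := eqEcard [set x in S | x - y \in S] S; rewrite sub /= => <-.
  apply/forall_inP/eqP => [Sy | eqS x].
    by apply/setP => x; rewrite inE; case: (boolP (x \in S)) => // /Sy ->.
  by rewrite -{1}eqS inE => /andP[].
have inv_rad : inv_function (mem rad).
  have [fA fU] := inv_conv inv_f inv_f.
  by split=> [x y xy|u x Uu]; rewrite /= !radE ?fU // (fA x y xy).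
have [radE0|radT] := prim_subgroup rad0 radD inv_rad.
  have : d \in rad by rewrite inE; apply/forall_inP => x; rewrite -(Sd (x - d)) subrKC.
  by rewrite radE0 inE (negPf d0).
apply/setP => x; rewrite inE.
have : - x \in rad by rewrite radT inE.
by rewrite inE => /forall_inP/(_ 0 S0); rewrite opprK add0r.
Qed.

End SringOverRingBlocks.

(** * Congruences and classes of characters *)

Section AlgebraicIntegerCongruences.
Local Open Scope ring_scope.

Lemma eqAmodX (e : algC) n : {in Aint &, forall x y,
  (x == y %[mod e])%A -> (x ^+ n == y ^+ n %[mod e])%A}.
Proof.
move=> x y Zx Zy exy; elim: n => [|n IHn]; rewrite ?expr0 // !exprS.
by apply: eqAmodM; rewrite // rpredX.
Qed.

Lemma eqAmod_exprDp (p : nat) : prime p -> {in Aint &, forall x y,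
  ((x + y) ^+ p == x ^+ p + y ^+ p %[mod (p%:R : algC)])%A}.
Proof.
move=> p_pr x y Zx Zy; case: p p_pr => // p p_pr.
rewrite exprDn big_ord_recl big_ord_recr /= subnn expr0 mulr1 mul1r.
rewrite !bin0 binn !mulr1n subn0 /eqAmod addrCA addrK.
apply: rpred_sum => i _; rewrite -eqAmod0.
have /dvdnP[m ->] : (p.+1 %| 'C(p.+1, i.+1))%N.
  by apply: prime_dvd_bin; rewrite //= ltnS ltn_ord.
by rewrite mulrnA -[X in eqAmod _ X _]mulr_natr eqAmodMl0 // rpredMn // rpredM ?rpredX.
Qed.

Lemma eqAmod_expr_sum (p k : nat) (I : Type) (r : seq I) (P : pred I) F :
    prime p -> (forall i, P i -> F i \in Aint) ->
  ((\sum_(i <- r | P i) F i) ^+ (p ^ k)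
     == \sum_(i <- r | P i) F i ^+ (p ^ k) %[mod (p%:R : algC)])%A.
Proof.
move=> p_pr ZF; elim: k => [|k IHk].
  by rewrite expn0 expr1 (eq_bigr F) // => i _; rewrite expr1.
rewrite expnSr exprM.
have ZX n : \sum_(i <- r | P i) F i ^+ n \in Aint.
  by apply: rpred_sum => i Pi; rewrite rpredX ?ZF.
have ZS : (\sum_(i <- r | P i) F i) ^+ (p ^ k) \in Aint.
  by rewrite rpredX // rpred_sum.
apply: eqAmod_trans (eqAmodX p ZS (ZX _) IHk) _.
(* Integrality of the partial sum travels with the congruence, because each binomial step requires
   it. *)
suff [] : \sum_(i <- r | P i) F i ^+ (p ^ k) \in Aint /\
  ((\sum_(i <- r | P i) F i ^+ (p ^ k)) ^+ p
     == \sum_(i <- r | P i) F i ^+ (p ^ k * p) %[mod (p%:R : algC)])%A by [].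
elim/big_rec2: _ => [|i b a Pi [Za eq_ab]].
  by rewrite rpred0 expr0n -[p]prednK ?prime_gt0.
split; first by rewrite rpredD ?rpredX ?ZF.
apply: eqAmod_trans (eqAmod_exprDp p_pr _ Za) _; first by rewrite rpredX ?ZF.
by rewrite -exprM; apply: eqAmodD.
Qed.

End AlgebraicIntegerCongruences.

Section DualClasses.
Local Open Scope ring_scope.
Variables (R : finComUnitRingType) (A : Sring R).
Hypothesis hA : Sring_over A.
Local Notation inv_function := (inv_function A).
Implicit Types x y z : R.

Lemma inv_ext T (f g : R -> T) : f =1 g -> inv_function f -> inv_function g.
Proof. by move=> eqfg [fA fU]; split=> [x y|u x]; rewrite -!eqfg; auto. Qed.

Lemma inv_affine (c d : algC) (f g : R -> algC) :
  inv_function f -> inv_function g -> inv_function (fun x => c * (f x + d * g x)).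
Proof.
move=> [fA fU] [gA gU].
by split=> [x y xy|u x Uu]; rewrite ?fU ?gU // (fA x y xy) (gA x y xy).
Qed.

(** For an S-ring over [R] the classes of this relation are the minimal nonempty unit-stable unions
    of basic sets, so their indicators span the invariant functions. *)
Definition inv_eq x z :=
  [exists u : R, (u \is a GRing.unit) && (u * x \in blk A z)].

Lemma inv_eq_refl x : inv_eq x x.
Proof. by apply/existsP; exists 1; rewrite unitr1 mul1r mem_blk. Qed.

Lemma inv_eq_inv z : inv_function (inv_eq^~ z).
Proof.
split=> [x y xy|v x Uv] /=.
  apply: eq_existsb => u; have [Uu|//] := boolP (u \is a GRing.unit).
  by have := blk_unit hA Uu xy; rewrite /= !blk_eq => /eqP->.
apply/existsP/existsP => -[u /andP[Uu]].
  by rewrite mulrA; exists (u * v); rewrite unitrM Uu Uv.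
by exists (u / v); rewrite unitrM unitrV Uu Uv -mulrA mulKr.
Qed.

Lemma inv_eq_const T (f : R -> T) x z :
  inv_function f -> inv_eq x z -> f x = f z.
Proof. by move=> [fA fU] /existsP[u /andP[Uu /fA<-]]; rewrite fU. Qed.

Definition inv_ind z x : algC := (inv_eq x z)%:R.

Lemma inv_ind_inv z : inv_function (inv_ind z).
Proof. exact: (inv_comp (fun b : bool => b%:R : algC) (inv_eq_inv z)). Qed.

(** Testing on the indicators [inv_ind z] suffices: they span all invariant functions. *)
Definition dual_eq (i j : dual R) :=
  [forall z, fourier (inv_ind z) i == fourier (inv_ind z) j].

Lemma dual_eqP i j : reflect
  (forall z, fourier (inv_ind z) i = fourier (inv_ind z) j) (dual_eq i j).
Proof. exact: 'forall_eqP. Qed.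

Lemma dual_eq_refl i : dual_eq i i.
Proof. exact/dual_eqP. Qed.

Lemma dual_eq_trans i j k : dual_eq i j -> dual_eq j k -> dual_eq i k.
Proof. by move=> /dual_eqP ij /dual_eqP jk; apply/dual_eqP => z; rewrite ij. Qed.

(* Lagrange interpolation in the algebra of Fourier transforms. *)
Lemma dual_class_ind i : exists2 h : R -> algC,
  inv_function h & forall j, fourier h j = (dual_eq i j)%:R.
Proof.
suff [h hI [h1 h0]] : exists2 h : R -> algC, inv_function h &
    (forall j, dual_eq i j -> fourier h j = 1) /\
    (forall j, j \in enum (dual R) -> ~~ dual_eq i j -> fourier h j = 0).
  exists h => // j; case: (boolP (dual_eq i j)) => [/h1 // | nij].
  by rewrite h0 ?mem_enum.
elim: (enum _) => [|j s [h hI [h1 h0]]].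
  exists (fun x => (x == 0)%:R); first exact: inv_delta.
  by split=> // j _; apply: fourier_delta.
have [ij | nij] := boolP (dual_eq i j).
  exists h => //; split=> // k; rewrite inE => /predU1P[->|/h0 //].
  by rewrite ij.
have /existsP[z zij] : [exists z, fourier (inv_ind z) i != fourier (inv_ind z) j].
  by move: nij; rewrite negb_forall.
rewrite -subr_eq0 in zij.
(* The transform of [g] is 1 on the class of [i] and 0 at [j]; the delta function at 0 supplies the
   constant term. *)
pose g x := (fourier (inv_ind z) i - fourier (inv_ind z) j)^-1 *
  (inv_ind z x + (- fourier (inv_ind z) j) * (x == 0)%:R).
have gE k : fourier g k = (fourier (inv_ind z) i - fourier (inv_ind z) j)^-1 *
    (fourier (inv_ind z) k - fourier (inv_ind z) j).
  by rewrite fourierZ fourierD fourierZ fourier_delta mulr1.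
exists (conv h g).
  by apply: inv_conv => //; apply: inv_affine; [apply: inv_ind_inv | apply: inv_delta].
split=> k; rewrite fourier_conv gE.
  by move=> ik; rewrite h1 // mul1r -(dual_eqP _ _ ik) mulVf.
rewrite inE => /predU1P[->|/h0 h0k /h0k ->]; rewrite ?mul0r //.
by rewrite subrr !mulr0.
Qed.

Definition class_fun i x : algC := \sum_(j | dual_eq i j) chr j x.

(** By Fourier inversion this sum is [#|R|] times the function whose transform is the indicator of
    the class; the sign in the inversion formula is absorbed by the unit [-1]. *)
Lemma class_fun_inv i : inv_function (class_fun i).
Proof.
have [h hI hE] := dual_class_ind i.
apply: (inv_ext (f := fun x => #|R|%:R * h x)); last first.
  exact: (inv_comp (fun a => #|R|%:R * a) hI).
move=> x; rewrite /= -(inv_oppr x hI) -fourier_inv.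
rewrite opprK [RHS]big_mkcond; apply: eq_bigr => j _; rewrite hE.
by case: (dual_eq i j); rewrite ?mul1r ?mul0r.
Qed.

Lemma class_fun_expp (p k : nat) i x : prime p ->
  (class_fun i x ^+ (p ^ k) == class_fun i (x *+ p ^ k) %[mod (p%:R : algC)])%A.
Proof.
move=> p_pr; apply: eqAmod_trans (eqAmod_expr_sum _ _ p_pr _) _.
  by move=> j _; apply: chr_Aint.
by rewrite [X in eqAmod _ _ X](eq_bigr _ (fun j _ => chrMn j x _)).
Qed.

End DualClasses.

(** * Invariant functions off the ideal H *)

Section SumsAndPermutations.
Local Open Scope ring_scope.

Lemma sum_mult0 (V : finZmodType) (E : {set V}) (F : V -> algC) d :
  (forall x, (d + x \in E) = (x \in E)) ->
  (forall x, F (d + x) = F d * F x) -> F d != 1 -> \sum_(x in E) F x = 0.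
Proof.
move=> Ed FD Fd; apply/eqP; have: (\sum_(x in E) F x) * (F d - 1) == 0.
  rewrite mulrBr mulr1 {2}(reindex_inj (addrI d)) /= subr_eq0 mulr_suml.
  by apply/eqP/eq_big => x; rewrite ?Ed // FD mulrC.
by rewrite mulf_eq0 subr_eq0 (negPf Fd) orbF.
Qed.

(** The group generated by [s] is a [p]-group, so [#|D|] is congruent modulo [p] to the number of
    its fixed points, which is 0. *)
Lemma dvdn_card_free_perm (T : finType) (p : nat) (s : {perm T}) (D : {set T}) :
  prime p -> (s ^+ p)%g = 1%g -> (forall x, x \in D -> s x \in D) ->
  (forall x, x \in D -> s x != x) -> (p %| #|D|)%N.
Proof.
move=> p_pr sp1 sD s_free.
have p_s : p.-group <[s]>.
  apply: (pnat_dvd (n := p)); last exact: pnat_id.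
  by rewrite -[#|_|]/#[s]%g order_dvdn sp1.
have actsD : [acts <[s]>, on D | 'P].
  rewrite cycle_subG; apply/astabsP => x /=; rewrite apermE.
  have sDD : s @: D = D.
    apply/eqP; rewrite eqEcard card_imset ?leqnn ?andbT; last exact: perm_inj.
    by apply/subsetP => _ /imsetP[y Dy ->]; apply: sD.
  apply/idP/idP => [|/sD //]; rewrite -{1}sDD => /imsetP[y Dy].
  by move/perm_inj->.
have := pgroup_fix_mod p_s actsD; rewrite /dvdn => ->.
rewrite (_ : 'Fix_(D | 'P)(<[s]>) = set0) ?cards0 ?mod0n //.
apply/setP => x; rewrite in_set0 in_setI; apply/negP => /andP[Dx].
move=> /afixP fix_x; have /= := fix_x s (cycle_id s); rewrite apermE => sx.
by have := s_free x Dx; rewrite sx eqxx.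
Qed.

End SumsAndPermutations.

Section LocalComponent.
Local Open Scope ring_scope.
Variables (R : finComUnitRingType) (A : Sring R).
Hypotheses (hA : Sring_over A) (hprim : quasiprimitive A).
Variables (p k : nat).
Hypothesis p_pr : prime p.
Let e' : R := (p ^ k)%:R.
Let e : R := 1 - e'.
Hypotheses (e'_idem : e' * e' = e') (e_neq0 : e != 0).
Variable H : {set R}.
Hypothesis H_add : forall x y, x \in H -> y \in H -> x + y \in H.
Hypothesis H_mul : forall a x, x \in H -> a * x \in H.
Hypotheses (H'1 : 1 \notin H) (He' : e' \in H) (Hp : p%:R \in H).
Hypothesis H'_unit : forall x, x \notin H -> exists y, e * x * y = e.

Implicit Types (x y z : R) (i j : dual R).

Lemma mul_ee' : e * e' = 0.
Proof. by rewrite mulrBl mul1r e'_idem subrr. Qed.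

Lemma mul_e'e : e' * e = 0.
Proof. by rewrite mulrC mul_ee'. Qed.

Lemma e_idem : e * e = e.
Proof. by rewrite {2}/e mulrBr mulr1 mul_ee' subr0. Qed.

Lemma add_ee' : e + e' = 1.
Proof. exact: subrK. Qed.

Lemma split_e x : e * x + e' * x = x.
Proof. by rewrite -mulrDl add_ee' mul1r. Qed.

Lemma unit_split u v : e * u * v = e -> e * u + e' \is a GRing.unit.
Proof.
move=> euv; apply/unitrPr; exists (e * v + e').
rewrite mulrDl 2!mulrDr mulrACA e_idem mulrA euv.
by rewrite mulrAC mul_ee' mul0r addr0 mulrA mul_e'e mul0r add0r e'_idem add_ee'.
Qed.

(** The unit [e * y + e'] inverts the [e]-component of [x] and leaves its [e']-component alone. *)
Lemma inv_function_off T (f : R -> T) x :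
  inv_function A f -> x \notin H -> f x = f (e + e' * x).
Proof.
move=> [_ fU] /H'_unit[y exy]; have eyx : e * y * x = e by rewrite mulrAC.
by rewrite -(fU _ x (unit_split eyx)) mulrDl eyx.
Qed.

(** Coincides with an invariant [f] off [H], and depends on the [e']-component only. *)
Definition off_part (f : R -> algC) x : algC := f (e + e' * x).

Definition nontriv i := [exists d, chr i (e * d) != 1].

Lemma fourier_off_part f i : nontriv i -> fourier (off_part f) i = 0.
Proof.
case/existsP=> d; apply: fourier_periodic => x.
by rewrite /off_part mulrDr mulrA mul_e'e mul0r add0r.
Qed.

(** The difference of [f] and [off_part f] is supported on [H], where [i] is trivial. *)
Lemma fourier_mul_off f i j : inv_function A f ->
    (forall x, x \in H -> chr i x = 1) ->
  fourier f (chr_mul i j) - fourier (off_part f) (chr_mul i j)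
    = fourier f j - fourier (off_part f) j.
Proof.
move=> fI iH; rewrite /fourier -!sumrB; apply: eq_bigr => x _.
rewrite -!mulrBl chr_mulE; have [Hx | H'x] := boolP (x \in H).
  by rewrite iH // mul1r.
by rewrite (inv_function_off fI H'x) subrr !mul0r.
Qed.

(** At characters nontrivial on eR the transform of every [off_part] vanishes, so [fourier_mul_off]
    compares the transforms of the indicators themselves. *)
Lemma dual_eq_mul i j : (forall x, x \in H -> chr i x = 1) ->
  nontriv j -> nontriv (chr_mul i j) -> dual_eq A j (chr_mul i j).
Proof.
move=> iH ntj ntij; apply/dual_eqP => z.
have := fourier_mul_off j (inv_ind_inv hA z) iH.
by rewrite !fourier_off_part // !subr0 => ->.
Qed.

Section TwistedClass.
Variable b : dual R.
Hypotheses (b_neq0 : b != 0) (b_triv : forall x, chr b (e * x) = 1).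

Definition twisted_class :=
  [set j | dual_eq A b j && [forall y, chr j (e' * y) == chr b (e' * y)]].

Lemma chr_split i x : chr i x = chr i (e * x) * chr i (e' * x).
Proof. by rewrite -chrD split_e. Qed.

Lemma class_fun_e' x :
  (class_fun A b (e' * x) == class_fun A b 0 %[mod (p%:R : algC)])%A.
Proof.
(* Defined through the value at [x], [S] inherits the invariance of [class_fun]; by [SE] it depends
   on e'x only, so [e] is a nonzero period. *)
pose S := [set x | (class_fun A b x ^+ (p ^ k)
                      == class_fun A b 0 %[mod (p%:R : algC)])%A].
have SE y : (y \in S) =
    (class_fun A b (e' * y) == class_fun A b 0 %[mod (p%:R : algC)])%A.
  rewrite inE (eqAmod_transl _ (class_fun_expp A k b y p_pr)).
  by rewrite -[y *+ _]mulr_natl.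
have S0 : 0 \in S by rewrite SE mulr0.
have SI : inv_function A (mem S).
  have := inv_comp (fun a : algC => (a ^+ (p ^ k)
    == class_fun A b 0 %[mod (p%:R : algC)])%A) (class_fun_inv hA b).
  by apply: inv_ext => y; rewrite /= inE.
rewrite -SE (periodic_setT hprim SI e_neq0) // => y.
by rewrite !SE mulrDr mul_e'e add0r.
Qed.

(** Pairing the class function with the inverse of [b] over E = e'R gives [#|twisted_class| * #|E|].
    Modulo [p] the class function is constant there, and [b] is nontrivial on E, so the pairing is 0
    modulo [p]. *)
Lemma dvd_twisted_class : (p %| #|twisted_class|)%N.
Proof.
pose E := [set x | e' * x == x].
have ED d x : d \in E -> (d + x \in E) = (x \in E).
  by rewrite !inE => /eqP Ed; rewrite mulrDr Ed (inj_eq (addrI d)).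
have Ee' x : e' * x \in E by rewrite inE mulrA e'_idem.
have sumE j : \sum_(y in E) chr j y * chr b (- y) =
    [forall y, chr j (e' * y) == chr b (e' * y)]%:R * #|E|%:R.
  case: forallP => [jb | njb].
    rewrite mul1r -sum1_card natr_sum; apply: eq_bigr => y.
    rewrite inE => /eqP Ey; have := eqP (jb y); rewrite Ey => ->.
    by rewrite -chrD subrr chr0.
  rewrite mul0r; have /forallPn[y jby] : ~~ [forall y, chr j (e' * y) == chr b (e' * y)].
    by apply/negP => /forallP.
  apply: (sum_mult0 (d := e' * y)) => [x|x|]; first exact: ED.
    by rewrite opprD !chrD mulrACA.
  apply: contra jby => /eqP jby; apply/eqP.
  by rewrite -[LHS]mulr1 -(chr0 b) -[in LHS](addNr (e' * y)) chrD mulrA jby mul1r.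
have Tcard : \sum_(y in E) class_fun A b y * chr b (- y)
    = (#|twisted_class| * #|E|)%:R.
  under eq_bigr => y _ do rewrite mulr_suml.
  rewrite exchange_big /=; under eq_bigr => j _ do rewrite sumE.
  rewrite -mulr_suml natrM; congr (_ * _); rewrite -sum1_card natr_sum.
  rewrite big_mkcond [RHS]big_mkcond; apply: eq_bigr => j _.
  by rewrite inE; case: (dual_eq _ _ _); case: ([forall y, _]).
have T0 : (\sum_(y in E) class_fun A b y * chr b (- y)
    == class_fun A b 0 * \sum_(y in E) chr b (- y) %[mod (p%:R : algC)])%A.
  rewrite mulr_sumr /eqAmod -sumrB; apply: rpred_sum => y.
  rewrite inE => /eqP Ey; have := class_fun_e' y; rewrite Ey => eq_y.
  exact: (eqAmodMr (chr_Aint b (- y)) eq_y).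
have sumb : \sum_(y in E) chr b (- y) = 0.
  have [x bx] := chr_neq0 b_neq0.
  apply: (sum_mult0 (d := - (e' * x))) => [y|y|]; last 1 first.
  - by rewrite opprK; move: bx; rewrite chr_split b_triv mul1r.
  - by apply: ED; rewrite -mulrN.
  by rewrite opprD chrD.
rewrite Tcard sumb mulr0 eqAmod0_nat Euclid_dvdM // in T0.
(* It remains to see that [p] does not divide [#|E|]: an element [x] of order [p] in E would satisfy
   [x = e' * x], which is [p ^ k] times [x], hence 0. *)
case/orP: T0 => // pE; case/negP: e_neq0.
have gE : group_set E.
  apply/group_setP; split; first by rewrite inE mulr0.
  by move=> x y Ex Ey; rewrite -[(x * y)%g]/(x + y) ED.
have [x Ex ox] := Cauchy (G := Group gE) p_pr pE.
have xp : x *+ p = 0 by rewrite -FinRing.zmodXgE -ox expg_order.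
have k_gt0 : (0 < k)%N.
  by rewrite lt0n; apply: contraNneq e_neq0 => k0; rewrite /e /e' k0 subrr.
have x0 : x = 0.
  move: Ex; rewrite inE => /eqP <-; rewrite mulr_natl -(prednK k_gt0) expnS.
  by rewrite mulrnA xp mul0rn.
by move: p_pr; rewrite -ox x0 (order1 R).
Qed.

Variable l : dual R.
Hypotheses (l_neq0 : l != 0) (lH : forall x, x \in H -> chr l x = 1).

Lemma nontrivPn j : j \in twisted_class -> ~~ nontriv j -> j = b.
Proof.
rewrite inE => /andP[_ /forallP jb] /existsPn ntj; apply: chr_inj => x.
rewrite !(chr_split _ x) (eqP (jb x)) b_triv; congr (_ * _).
by apply/eqP; move: (ntj x); rewrite negbK.
Qed.

Lemma lH_e' x : chr l (e' * x) = 1.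
Proof. by apply: lH; rewrite mulrC H_mul. Qed.

Lemma nontriv_lb : nontriv (chr_mul l b).
Proof.
have [x lx] := chr_neq0 l_neq0; apply/existsP; exists x.
by rewrite chr_mulE b_triv mulr1; move: lx; rewrite chr_split lH_e' mulr1.
Qed.

(** Otherwise multiplication by [l], whose [p]-th power is trivial because [p] lies in [H], permutes
    [twisted_class :\ b] without fixed points. Then [p] divides the size of the twisted class both
    with and without [b]. *)
Lemma dual_eq_twist : dual_eq A b (chr_mul l b).
Proof.
apply: contraT => nlb; pose D := twisted_class :\ b.
have Db : b \in twisted_class by rewrite inE dual_eq_refl; apply/forallP.
have := dvd_twisted_class; rewrite (cardsD1 b) Db -/D.
suff pD : (p %| #|D|)%N by rewrite dvdn_addl // dvdn1 => /eqP p1; move: p_pr; rewrite p1.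
have lE := permE (@chr_mulI R l).
have ntb : ~~ nontriv b by apply/existsPn => x; rewrite b_triv eqxx.
apply: (@dvdn_card_free_perm _ _ (perm (@chr_mulI R l))) => //.
- apply/permP => j; rewrite permX perm1; apply: chr_inj => x.
  have iterE n : chr (iter n (perm (@chr_mulI R l)) j) x = chr l x ^+ n * chr j x.
    elim: n => [|n IHn]; first by rewrite expr0 mul1r.
    by rewrite iterS lE chr_mulE IHn exprS mulrA.
  by rewrite iterE -chrMn -mulr_natr lH ?mul1r ?H_mul.
- move=> j; rewrite lE !in_setD1 => /andP[jb Dj].
  have ntj : nontriv j by apply: contraR jb => /(nontrivPn Dj)->.
  have /andP[bj /forallP jb'] :
      dual_eq A b j && [forall y, chr j (e' * y) == chr b (e' * y)].
    by move: Dj; rewrite inE.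
  have lj_tw : chr_mul l j \in twisted_class -> chr_mul l j != b ->
      (chr_mul l j != b) && (chr_mul l j \in twisted_class) by move=> -> ->.
  have lj_e' : [forall y, chr (chr_mul l j) (e' * y) == chr b (e' * y)].
    by apply/forallP => y; rewrite chr_mulE lH_e' mul1r.
  (* If [l j] were trivial on eR it would equal [b]. Then [l b] is the product of [l l] and [j],
     hence equivalent to [j] and so to [b], contrary to [nlb]. *)
  have ntlj : nontriv (chr_mul l j).
    apply: contraR nlb => ntlj.
    have ljb : chr_mul l j = b.
      apply: chr_inj => x; rewrite !(chr_split _ x) b_triv (eqP (forallP lj_e' x)).
      by congr (_ * _); apply/eqP; move/existsPn/(_ x): ntlj; rewrite negbK.
    apply: dual_eq_trans bj _.
    have llj : chr_mul l b = chr_mul (chr_mul l l) j.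
      by apply: chr_inj => x; rewrite -ljb !chr_mulE mulrA.
    rewrite llj; apply: dual_eq_mul => // [x Hx|]; last by rewrite -llj nontriv_lb.
    by rewrite chr_mulE lH ?mulr1.
  apply: lj_tw; last by apply: contraNneq ntb => <-.
  by rewrite inE lj_e' andbT (dual_eq_trans bj) // dual_eq_mul.
- move=> j _; rewrite lE; apply: contra l_neq0 => /eqP lj; apply/eqP/chr_inj => x.
  rewrite chr0E; have /eqP := congr1 (fun i : dual R => chr i x) lj.
  rewrite /= chr_mulE -subr_eq0 -{2}[chr j x]mul1r -mulrBl mulf_eq0 subr_eq0.
  by rewrite (negPf (chr_nz _ _)) orbF => /eqP.
Qed.

End TwistedClass.

(** The [off_part] of the indicator of the class of [y] is shown to be constant, all its nontrivial
    Fourier coefficients being 0; off [H] it equals the indicator. *)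
Lemma inv_eq_off x y : x \notin H -> y \notin H -> inv_eq A x y.
Proof.
have H0 : 0 \in H by rewrite -(mul0r e') H_mul.
have [||||l l0 lH] := @dual_separates R H => //.
- by move=> z Hz; rewrite -mulN1r H_mul.
- by apply: contraNneq H'1 => ->; rewrite inE.
have fI := inv_ind_inv hA y; move=> H'x H'y.
suff /fourier_const/(_ x y) : forall i, i != 0 -> fourier (off_part (inv_ind A y)) i = 0.
  rewrite /off_part -!(inv_function_off fI) // /inv_ind inv_eq_refl => /eqP.
  by rewrite eqr_nat; case: (inv_eq A x y).
move=> i i0; have [/fourier_off_part // | /existsPn nti] := boolP (nontriv i).
have {}nti z : chr i (e * z) = 1 by apply/eqP; move: (nti z); rewrite negbK.
(* As [i] and [l i] are equivalent, [fourier_mul_off] gives the [off_part] equal coefficients at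
   both, and the one at [l i] is 0. *)
have /dual_eqP/(_ y) il := dual_eq_twist i0 nti l0 lH.
have := fourier_mul_off i fI lH; rewrite -il.
rewrite (fourier_off_part _ (nontriv_lb nti l0 lH)) subr0 => /eqP.
by rewrite -subr_eq0 opprB addrC subrK => /eqP.
Qed.

End LocalComponent.

(** * Transitivity on basic sets *)

Section Transitivity.
Local Open Scope ring_scope.
Variables (R : finComUnitRingType) (A : Sring R).
Hypotheses (hA : Sring_over A) (hprim : quasiprimitive A).
Implicit Types (x y z : R).

Lemma inv_eq_sym x y : inv_eq A x y -> inv_eq A y x.
Proof. by move/(inv_eq_const (inv_eq_inv hA x)) <-; apply: inv_eq_refl. Qed.

Lemma inv_eq_trans x y z : inv_eq A x y -> inv_eq A y z -> inv_eq A x z.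
Proof. by move/(inv_eq_const (inv_eq_inv hA z)) ->. Qed.

(** The convolution of the two class indicators is positive at [x + y], hence at the equivalent [z];
    a nonzero summand there gives the decomposition. *)
Lemma inv_eq_addP x y z : inv_eq A (x + y) z ->
  exists s t, [/\ z = s + t, inv_eq A s x & inv_eq A t y].
Proof.
have fI := inv_conv (inv_ind_inv hA x) (inv_ind_inv hA y).
move/(inv_eq_const fI) => eq_f.
have : conv (inv_ind A x) (inv_ind A y) z != 0.
  rewrite -eq_f /conv (bigD1 x) //= addrAC subrr add0r /inv_ind !inv_eq_refl mulr1.
  rewrite gt_eqF // ltr_wpDr ?ltr01 // sumr_ge0 // => t _.
  by rewrite mulr_ge0 ?ler0n.
move=> conv_nz.
have /existsP[s] : [exists s, inv_ind A x s * inv_ind A y (z - s) != 0].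
  apply: contraNT conv_nz => /existsPn all0; apply/eqP/big1 => s _.
  by apply/eqP; move: (all0 s); rewrite negbK.
rewrite /inv_ind -natrM mulnb pnatr_eq0 eqb0 negbK => /andP[sx ty].
by exists s, (z - s); rewrite subrKC.
Qed.

Variable H : {set R}.
Hypothesis H_add : forall x y, x \in H -> y \in H -> x + y \in H.
Hypotheses (H0 : 0 \in H) (H'1 : 1 \notin H).
Hypothesis H'eq : forall x y, x \notin H -> y \notin H -> inv_eq A x y.

(** The elements whose whole class lies in [H] form an invariant subgroup missing 1, so only 0 is
    such. Every nonzero class thus leaves [H], where all elements are equivalent. *)
Lemma inv_eq_neq0 x y : x != 0 -> y != 0 -> inv_eq A x y.
Proof.
pose Y := [set z | [forall t, inv_eq A z t ==> (t \in H)]].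
have YP z : reflect (forall t, inv_eq A z t -> t \in H) (z \in Y).
  rewrite inE; apply: (iffP forallP) => [Yz t /(implyP (Yz t)) // | Yz t].
  exact/implyP/Yz.
have Y0 : 0 \in Y.
  apply/YP => t /inv_eq_sym/existsP[u /andP[Uu]].
  by rewrite blk0 inE mulrI_eq0 => [/eqP->|] //; apply: mulrI.
have YD s t : s \in Y -> t \in Y -> s + t \in Y.
  move=> /YP Ys /YP Yt; apply/YP => z /inv_eq_addP[a [b [->]]].
  move=> /inv_eq_sym/Ys Ha /inv_eq_sym/Yt Hb.
  exact: H_add.
have YI : inv_function A (mem Y).
  by split=> [s t st|u s Uu] /=; rewrite !inE; apply: eq_forallb => z;
     [rewrite ((inv_eq_inv hA z).1 _ _ st) | rewrite ((inv_eq_inv hA z).2 _ _ Uu)].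
have [YE | YT] := prim_subgroup hprim Y0 YD YI; last first.
  have /YP/(_ 1 (inv_eq_refl _ _)) : 1 \in Y by rewrite YT inE.
  by rewrite (negPf H'1).
have Yn z : z != 0 -> exists2 t, t \notin H & inv_eq A z t.
  have : (z \in Y) = (z == 0) by rewrite YE inE.
  move=> <-; rewrite inE negb_forall => /existsP[t].
  by rewrite negb_imply => /andP[zt Ht]; exists t.
move=> /Yn[s Hs xs] /Yn[t Ht yt]; apply: inv_eq_trans xs _.
by apply: inv_eq_trans (H'eq Hs Ht) _; apply: inv_eq_sym.
Qed.

End Transitivity.

(** * Units acting transitively on the nonzero basic sets *)

Section TransitiveUnits.
Local Open Scope ring_scope.
Variables (R : finComUnitRingType) (A : Sring R).
Hypothesis hA : Sring_over A.
Hypothesis trA : forall x y : R, x != 0 -> y != 0 -> inv_eq A x y.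
Implicit Types (u v x y z : R).
Local Notation blk := (blk A).

Lemma inv_eqP x y : x != 0 -> y != 0 ->
  exists2 u, u \is a GRing.unit & u * x \in blk y.
Proof. by move=> x0 y0; have /existsP[u /andP[]] := trA x0 y0; exists u. Qed.

Lemma blk_neq0 x y : y \in blk x -> (y == 0) = (x == 0).
Proof.
have E z : (z == 0) = (z \in blk 0) by rewrite blk0 inE.
by rewrite !E !blk_eq => /eqP->.
Qed.

(* The units form an abelian group that is transitive on the nonzero blocks,
   so the stabiliser of one of them stabilises them all. *)
Lemma unit_fix_blk u x y : u \is a GRing.unit -> x != 0 ->
  u * x \in blk x -> u * y \in blk y.
Proof.
move=> Uu x0 ux; have [->|y0] := eqVneq y 0; first by rewrite mulr0 mem_blk.
have [v Uv vx] := inv_eqP x0 y0.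
have := blk_unit hA Uv ux; rewrite !blk_eq mulrCA => /eqP eq1.
have := blk_unit hA Uu vx; rewrite !blk_eq => /eqP eq2.
by rewrite -eq2 eq1 -blk_eq.
Qed.

Lemma Srank2 : (forall u x, u \is a GRing.unit -> u * x \in blk x) ->
  Srank A = 2%N.
Proof.
move=> fixA; rewrite /Srank.
suff -> : basic_sets A = [set [set 0]; blk 1].
  rewrite cards2; suff -> : [set 0] != blk 1 by [].
  by apply: contraNneq (oner_neq0 R) => E0; have := mem_blk A 1; rewrite -E0 inE.
apply/setP => X; rewrite in_set2; apply/idP/orP => [SX|[]/eqP->]; last first.
- exact: blk_basic.
- exact: sr_one.
have /set0Pn[x Xx] : X != set0.
  by apply: contraTneq SX => ->; case/and3P: (sr_partition A).
rewrite -(blk_def SX Xx); have [->|x0] := eqVneq x 0; [left | right].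
  by rewrite blk0.
have [u Uu] := inv_eqP x0 (oner_neq0 R).
by rewrite !blk_eq => /eqP <-; rewrite -blk_eq blk_sym fixA.
Qed.

(* With orthogonal idempotents e and e', every unit is a product of one fixing
   e and one fixing e'. *)
Lemma Srank2_split (e e' : R) : e + e' = 1 -> e * e' = 0 ->
  e != 0 -> e' != 0 -> Srank A = 2%N.
Proof.
move=> ee1 ee0 e0 e'0.
have ee : e * e = e by rewrite -[RHS]mulr1 -ee1 mulrDr ee0 addr0.
have e'e' : e' * e' = e'.
  by rewrite -[RHS]mulr1 -ee1 mulrDr [e' * e]mulrC ee0 add0r.
have U1 u : u \is a GRing.unit -> e * u + e' \is a GRing.unit.
  move=> Uu; apply/unitrPr; exists (e * u^-1 + e').
  rewrite mulrDl 2!mulrDr mulrACA ee divrr // mulr1 mulrAC ee0 mul0r addr0.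
  by rewrite mulrA [e' * e]mulrC ee0 mul0r add0r e'e' ee1.
apply: Srank2 => u x Uu.
have uE : (e + e' * u) * (e * u + e') = u.
  rewrite mulrDl 2!mulrDr mulrA ee ee0 addr0 mulrACA [e' * e]mulrC ee0 mul0r add0r.
  by rewrite mulrAC e'e' -mulrDl ee1 mul1r.
have Uu2 : e + e' * u \is a GRing.unit by move: Uu; rewrite -{1}uE unitrM => /andP[].
rewrite -uE -mulrA; have fix1 y := unit_fix_blk y (U1 u Uu) e'0.
have fix2 y := unit_fix_blk y Uu2 e0.
have {}fix1 y : (e * u + e') * y \in blk y.
  by apply: fix1; rewrite mulrDl mulrAC ee0 mul0r add0r e'e' mem_blk.
have {}fix2 y : (e + e' * u) * y \in blk y.
  by apply: fix2; rewrite mulrDl mulrAC [e' * e]mulrC ee0 mul0r addr0 ee mem_blk.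
by have := fix1 x; rewrite blk_eq => /eqP <-.
Qed.

(** K consists of the unit multiplications stabilising every basic set. For [y] in the block of
    [x != 0], the unit [y / x] fixes that block, hence all blocks, and carries [x] to [y]. *)
Lemma field_cyclotomic : GRing.field_axiom R -> cyclotomic A.
Proof.
move=> fieldR.
pose K := [set k in unit_mults R | [forall x, k x \in blk x]].
have gK : group_set K.
  apply/group_setP; split.
    by rewrite inE group1; apply/forallP => x; rewrite perm1 mem_blk.
  move=> k l; rewrite !inE => /andP[Kk /forallP fixk] /andP[Kl /forallP fixl].
  rewrite groupM //; apply/forallP => x; rewrite permM.
  by have := fixl (k x); rewrite !blk_eq => /eqP->; rewrite -blk_eq.
exists (Group gK); first by apply/subsetP => k; rewrite inE => /andP[].
move=> a; split=> [/sr_blockwise aA k|aK].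
  rewrite inE => /andP[_ /forallP fixk]; apply: group_ringP => x.
  by rewrite -[x](permKV k) coefg_gract; rewrite (aA _ _ (fixk _)).
apply/sr_blockwise => x y xy.
have [x0|x0] := eqVneq x 0; first by move: xy; rewrite x0 blk0 inE => /eqP->.
have Ux : x \is a GRing.unit := fieldR x x0.
have Uy : y \is a GRing.unit by apply: fieldR; rewrite (blk_neq0 xy).
have Uyx : y / x \is a GRing.unit by rewrite unitrM Uy unitrV.
have [k Kk kE] := unit_mult_perm Uyx.
have yE : y = k x by rewrite kE divrK.
rewrite yE -[RHS](coefg_gract k) aK // inE Kk; apply/forallP => z.
by rewrite kE; apply: (unit_fix_blk _ Uyx x0); rewrite divrK.
Qed.

(** * Counting differences in a local ring with nonzero maximal ideal *)

Section Counting.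
Variable H : {set R}.
Hypothesis H_add : forall x y, x \in H -> y \in H -> x + y \in H.
Hypothesis H_mul : forall a x, x \in H -> a * x \in H.
Hypothesis H'1 : 1 \notin H.
Hypothesis H_unit : forall x, (x \is a GRing.unit) = (x \notin H).
Hypothesis H_neq0 : exists2 h, h \in H & h != 0.

Let X := blk 1.

Lemma H_sub x y : x \in H -> y \in H -> x - y \in H.
Proof. by move=> Hx Hy; rewrite H_add // -mulN1r H_mul. Qed.

Lemma one_add_unit h : h \in H -> 1 + h \is a GRing.unit.
Proof.
move=> Hh; rewrite H_unit; apply: contra H'1 => /H_sub/(_ Hh).
by rewrite addrK.
Qed.

(* The nonunit h kills some x != 0, which 1 + h then fixes. *)
Lemma one_add_fix h y : h \in H -> (1 + h) * y \in blk y.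
Proof.
move=> Hh.
have [x x0 hx0] : exists2 x, x != 0 & h * x = 0.
  suff /existsP[x /andP[x0 /eqP hx]] : [exists x, (x != 0) && (h * x == 0)] by exists x.
  apply: contraTT Hh => /existsPn noz; rewrite -H_unit.
  (* By finiteness, multiplication by a non-zero-divisor is surjective, which would make [h] a
     unit. *)
  have inj : injective ( *%R h).
    move=> a b /eqP; rewrite -subr_eq0 -mulrBr => hab; apply/eqP.
    by rewrite -subr_eq0; apply: contraT => ab0; move: (noz (a - b)); rewrite ab0 hab.
  by apply/unitrPr; exists (invF inj 1); apply: f_invF.
apply: (unit_fix_blk _ (one_add_unit Hh) x0).
by rewrite mulrDl mul1r hx0 addr0 mem_blk.
Qed.

Lemma add_H_blk a h : a \notin H -> h \in H -> a + h \in blk a.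
Proof.
move=> Ha Hh; have Ua : a \is a GRing.unit by rewrite H_unit.
have -> : a + h = (1 + h / a) * a by rewrite mulrDl mul1r divrK.
by apply: one_add_fix; rewrite mulrC H_mul.
Qed.

Let r := #|basic_sets A :\ [set 0]|.

(** Units carry [X] onto each of the [r] nonzero basic sets and preserve [Z], so [Z] meets all of
    them equally often. *)
Lemma card_inv_set (Z : {set R}) : 0 \notin Z ->
  (forall u x, u \is a GRing.unit -> (u * x \in Z) = (x \in Z)) ->
  #|Z| = (r * #|Z :&: X|)%N.
Proof.
move=> Z'0 ZU; rewrite -sum1_card.
rewrite (eq_bigl (fun x => (x \in [set: R]) && (x \in Z))); last first.
  by move=> x; rewrite inE.
rewrite -(cover_partition (sr_partition A)) big_trivIset_cond /=; last first.
  exact: partition_trivIset (sr_partition A).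
rewrite (big_setD1 [set 0]) ?sr_one //= big_pred0 ?add0n; last first.
  by move=> x; rewrite inE; apply: contraNF Z'0 => /andP[/eqP->].
rewrite -sum_nat_const; apply: eq_bigr => Y; rewrite in_setD1 => /andP[Y0 SY].
have /set0Pn[y Yy] : Y != set0.
  by apply: contraTneq SY => ->; case/and3P: (sr_partition A).
have y0 : y != 0.
  by apply: contra Y0 => /eqP y0; rewrite -(blk_def SY Yy) y0 blk0.
have [u Uu uy] := inv_eqP (oner_neq0 R) y0.
have -> : Y = [set u * x | x in X].
  rewrite -(blk_def SY Yy); apply/setP => z; apply/idP/imsetP => [yz | [x Xx ->]].
    exists (u^-1 * z); last by rewrite mulVKr.
    rewrite /X -(blk_unit_eq hA _ _ Uu) mulVKr //.
    by move: yz uy; rewrite !blk_eq => /eqP-> /eqP->.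
  by have := blk_unit hA Uu Xx; move: uy; rewrite !blk_eq => /eqP->.
rewrite sum1dep_card -[RHS](card_imset _ (mulrI Uu)); apply: eq_card => z.
rewrite !inE. apply/andP/imsetP => [[/imsetP[x Xx ->]] | [x]].
  by rewrite ZU // => Zx; exists x; rewrite // inE Zx.
by rewrite inE => /andP[Zx Xx] ->; rewrite ZU // imset_f.
Qed.

(** The coefficient at [y] of the product of [xi X] with its image under negation. *)
Let c y := #|[set a in X | a - y \in X]|.

Lemma card_diff_blk : blockwise A c.
Proof.
have X_blk : blockwise A (fun x => (x \in X)%:R : algC).
  by move=> x y; rewrite blk_eq /X !blk_eq => /eqP->.
have XN_blk : blockwise A (fun x => (- x \in X)%:R : algC).
  move=> x y /(blk_unit hA (unitrN1 R)); rewrite !mulN1r; exact: X_blk.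
have cE y : (c y)%:R = conv (fun x => (x \in X)%:R) (fun x => (- x \in X)%:R) y :> algC.
  rewrite /c -sum1_card natr_sum big_mkcond /=; apply: eq_bigr => a _.
  by rewrite inE opprB; case: (a \in X); case: (_ \in X); rewrite ?mul1r ?mul0r.
move=> x y xy; apply/eqP; rewrite -(eqr_nat algC) !cE.
by rewrite (blockwise_conv X_blk XN_blk xy).
Qed.

(** Some nonzero element of [H] lies in the block of [y] and gives the same count; subtracting it
    keeps each element of [X] off [H] inside its block [X]. *)
Lemma card_diff_ge y : y != 0 -> (#|~: H :&: X| <= c y)%N.
Proof.
have [h Hh h0] := H_neq0; move=> y0; have [u Uu uh] := inv_eqP h0 y0.
rewrite -(card_diff_blk uh) /c; apply: subset_leq_card; apply/subsetP => a.
rewrite !inE => /andP[Ha Xa]; rewrite Xa /=.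
have : a - u * h \in blk a by apply: add_H_blk => //; rewrite -mulNr H_mul.
by move: Xa; rewrite /X !blk_eq => /eqP->.
Qed.

Lemma sum_card_diff : (\sum_y c y = #|X| * #|X|)%N.
Proof.
rewrite /c; under eq_bigr => y _ do rewrite -sum1dep_card big_mkcondr /=.
rewrite exchange_big /= -sum_nat_const; apply: eq_bigr => a Xa.
rewrite (reindex_inj (subrI a)) /= -sum1_card [RHS]big_mkcond.
by apply: eq_bigr => y _; rewrite opprB subrKC.
Qed.

(** Summing the lower bound on [c] over all [y != 0] gives [#|~: H| < #|X|]. Yet [~: H] contains
    [1 + H], hence at least half of R, whereas [X] is smaller than half of R once [r > 1]. *)
Lemma Srank2_local : Srank A = 2%N.
Proof.
have S1 : Srank A = r.+1 by rewrite /Srank (cardsD1 [set 0]) sr_one.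
have X0 : 0 \notin X by rewrite /X blk_sym blk0 inE oner_eq0.
have H0 : 0 \in H by have [h Hh _] := H_neq0; rewrite -(mul0r h) H_mul.
have r0 : (0 < r)%N.
  apply/card_gt0P; exists X; rewrite in_setD1 blk_basic andbT.
  by apply: contraNneq X0 => ->; rewrite inE.
rewrite S1; have [-> | r1] := eqVneq r 1%N; first by [].
have X_gt0 : (0 < #|X|)%N by apply/card_gt0P; exists 1; apply: mem_blk.
have EX : (#|R|.-1 = r * #|X|)%N.
  have -> : X = [set~ 0] :&: X.
    by apply/setP => x; rewrite !inE; case: eqP X0 => // -> /negPf.
  rewrite -card_inv_set ?inE ?eqxx ?cardsC1 //.
  by move=> u x Uu; rewrite !inE mulrI_eq0 //; apply: mulrI.
have EH : (#|~: H| = r * #|~: H :&: X|)%N.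
  apply: card_inv_set; first by rewrite inE H0.
  by move=> u x Uu; rewrite !inE -!H_unit unitrM Uu.
have HH : (#|H| <= #|~: H|)%N.
  rewrite -(card_imset _ (addrI (1 : R))); apply: subset_leq_card.
  by apply/subsetP => _ /imsetP[h Hh ->]; rewrite inE -H_unit one_add_unit.
have HC : (#|H| + #|~: H| = #|R|)%N := cardsC H.
have c0 : c 0 = #|X|.
  by apply: eq_card => a; rewrite inE subr0 andbb.
have cX : (#|X| + #|R|.-1 * #|~: H :&: X| <= #|X| * #|X|)%N.
  rewrite -sum_card_diff (bigD1 0) //= c0 leq_add2l.
  rewrite -(_ : #|[pred y : R | (y != 0)%R]| = #|R|.-1)%N.
    by rewrite -sum_nat_const; apply: leq_sum => y; apply: card_diff_ge.
  by rewrite [in RHS](cardD1 0) inE; apply: eq_card => y; rewrite !inE andbT.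
have : (#|X| + #|~: H| * #|X| <= #|X| * #|X|)%N.
  by rewrite EH mulnAC -EX.
rewrite -[X in (X + _ <= _)%N]mul1n -mulnDl leq_pmul2r // => leX.
have : (2 * #|X| <= r * #|X|)%N by rewrite leq_mul2r orbC; lia.
lia.
Qed.

End Counting.

End TransitiveUnits.

(** * Cyclotomic quasiprimitive S-rings live over fields *)

Section CyclotomicField.
Local Open Scope ring_scope.
Variables (R : finComUnitRingType) (A : Sring R).

(** The principal ideal of [x] is stable under all units, so its indicator is fixed by K and it is
    an invariant A-subgroup; being nonzero, it contains 1. *)
Lemma cyclotomic_field :
  quasiprimitive A -> cyclotomic A -> GRing.field_axiom R.
Proof.
move=> hprim [K sKU AK] x x0; pose I : {set R} := [set y * x | y : R].
have I0 : 0 \in I by apply/imsetP; exists 0; rewrite ?mul0r.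
have ID y z : y \in I -> z \in I -> y + z \in I.
  move=> /imsetP[s _ ->] /imsetP[t _ ->]; apply/imsetP.
  by exists (s + t); rewrite ?mulrDl.
have IU u y : u \is a GRing.unit -> (u * y \in I) = (y \in I).
  move=> Uu; apply/imsetP/imsetP => -[z _ zE]; last by exists (u * z); rewrite ?zE ?mulrA.
  by exists (u^-1 * z); rewrite // -mulrA -zE mulKr.
have II : inv_function A (mem I).
  split=> [y z yz|u y Uu]; last exact: IU.
  have : xi I \in sr_mem A.
    apply/AK => k Kk; have /unit_multsP[u Uu kE] := subsetP sKU k Kk.
    apply: group_ringP => t; rewrite -[t](permKV k) coefg_gract !coefg_xi.
    by rewrite kE IU.
  move/sr_blockwise/(_ y z yz)/eqP; rewrite !coefg_xi eqr_nat.
  by rewrite /=; case: (z \in I); case: (y \in I).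
have [E | E] := prim_subgroup hprim I0 ID II.
  have : x \in I by apply/imsetP; exists 1; rewrite ?mul1r.
  by rewrite E inE => /eqP x00; rewrite x00 eqxx in x0.
have : 1 \in I by rewrite E inE.
by case/imsetP=> y _ yx; apply/unitrPr; exists y; rewrite mulrC.
Qed.

End CyclotomicField.

(** * The local component *)

Section LocalData.
Local Open Scope ring_scope.
Variables (R : finComUnitRingType) (p : nat).
Hypotheses (p_pr : prime p) (p_dvd : (p %| #|R|)%N).

Lemma mulr_card (x : R) : x *+ #|R| = 0.
Proof. by rewrite -FinRing.zmodXgE -cardsT expg_cardG ?inE. Qed.

(** With this exponent the power of [p] is divisible by the [p]-part of [#|R|] and, by Euler, is 1
    modulo the [p']-part, so it becomes an idempotent of R. *)
Definition idem_exp := (logn p #|R| * totient #|R|`_p^')%N.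

Let e' : R := (p ^ idem_exp)%:R.
Let e : R := 1 - e'.

Lemma dvdn_part_idem : (#|R|`_p %| p ^ idem_exp)%N.
Proof.
rewrite p_part dvdn_exp2l // -{1}[logn _ _]muln1 leq_mul2l.
by rewrite totient_gt0 part_gt0 orbT.
Qed.

Lemma idem_e' : e' * e' = e'.
Proof.
set N := (p ^ idem_exp)%N; have N_gt0 : (0 < N)%N by rewrite expn_gt0 prime_gt0.
suff /dvdnP[q qE] : (#|R| %| N * N.-1)%N.
  rewrite -natrM -[(N * N)%N](_ : N * N.-1 + N = _)%N.
    by rewrite natrD qE natrM mulr_natr mulr_card add0r.
  by rewrite -mulnSr prednK.
rewrite -[X in (X %| _)%N](partnC p) -?cardsT ?cardG_gt0 // cardsT.
apply: dvdn_mul; first exact: dvdn_part_idem.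
rewrite -subn1 -eqn_mod_dvd // /N /idem_exp expnM; apply/eqP/Euler_exp_totient.
rewrite coprimeXl // prime_coprime // -p'natE //.
exact: part_pnat.
Qed.

Lemma primary_setP x : (x \in primary_set R p) = (e' * x == 0).
Proof.
rewrite primary_setE mulr_natl -FinRing.zmodXgE -[_ == 0]order_dvdn.
apply/idP/idP => [px | /pnat_dvd]; last by apply; rewrite pnatX pnat_id.
apply: dvdn_trans dvdn_part_idem; rewrite -(part_pnat_id px) partn_dvd //.
  by rewrite (cardD1 0).
by rewrite -cardsT order_dvdG ?inE.
Qed.

Lemma e'_mul_e : e' * e = 0.
Proof. by rewrite mulrBr mulr1 idem_e' subrr. Qed.

Lemma e_neq0 : e != 0.
Proof.
have pT : (p %| #|[set: R]|)%N by rewrite cardsT.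
have [x _ ox] := Cauchy (G := [set: R]%G) p_pr pT.
apply: contraTneq p_pr => /eqP; rewrite subr_eq0 => /eqP e'1.
suff x0 : x = 0 by rewrite -ox x0 (order1 R).
have : x \in primary_set R p by rewrite primary_setE /p_elt ox pnat_id.
by rewrite primary_setP -e'1 mul1r => /eqP.
Qed.

Lemma e_primary x : e * x \in primary_set R p.
Proof. by rewrite primary_setP mulrA e'_mul_e mul0r. Qed.

Lemma e_one : ((1%R : R).`_p)%g = e.
Proof.
have e_prim : e \in primary_set R p by rewrite -[e]mulr1 e_primary.
rewrite -[RHS](primary_set_mul1 e_prim) mulrBr mulr1 mulrC.
have := primary_set_one R p; rewrite primary_setP => /eqP->.
by rewrite subr0.
Qed.

Definition comp_nonunits := [set x | ~~ [exists y, e * x * y == e]].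

Let pr x := Primary (e_primary x).

Lemma e_mul_e : e * e = e.
Proof. by rewrite {1}/e mulrBl mul1r e'_mul_e subr0. Qed.

Lemma comp_nonunitsP x :
  (x \in comp_nonunits) <-> ~ invertible (pr x).
Proof.
rewrite inE; split=> [/existsPn nx [y /(congr1 val)] | nx].
  by rewrite /= e_one => xy; have := nx (val y); rewrite xy eqxx.
apply/existsP => -[y /eqP xy]; case: nx; exists (pr y); apply: val_inj => /=.
by rewrite e_one mulrACA e_mul_e mulrA.
Qed.

Hypothesis localR : local_ring (primary_component R p).

Lemma comp_nonunits_add x y :
  x \in comp_nonunits -> y \in comp_nonunits -> x + y \in comp_nonunits.
Proof.
have [_ ID _] := localR.
move=> /comp_nonunitsP nx /comp_nonunitsP ny; apply/comp_nonunitsP.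
suff -> : pr (x + y) = pr x + pr y by apply: ID.
by apply: val_inj; rewrite /= mulrDr.
Qed.

Lemma comp_nonunits_mul a x :
  x \in comp_nonunits -> a * x \in comp_nonunits.
Proof.
rewrite !inE; apply: contra => /existsP[y /eqP axy]; apply/existsP.
by exists (a * y); rewrite mulrA -[e * x * a]mulrA [x * a]mulrC axy.
Qed.

Lemma comp_nonunits1 : 1 \notin comp_nonunits.
Proof. by rewrite inE negbK; apply/existsP; exists 1; rewrite !mulr1. Qed.

Lemma comp_nonunits_e' : e' \in comp_nonunits.
Proof.
rewrite inE; apply/existsPn => y.
by rewrite [e * e']mulrC e'_mul_e mul0r eq_sym e_neq0.
Qed.

(** Were [p] invertible in eR, so would be its power [e'], yet [e * e' = 0]. *)
Lemma comp_nonunits_p : p%:R \in comp_nonunits.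
Proof.
rewrite inE; apply/existsPn => y; apply: contraNneq e_neq0 => epy.
have epyn n : e * p%:R ^+ n * y ^+ n = e.
  elim: n => [|n IHn]; first by rewrite !mulr1.
  by rewrite !exprS mulrACA -mulrACA -mulrA mulrACA !mulrA epy IHn.
by rewrite -(epyn idem_exp) -natrX [e * _]mulrC e'_mul_e mul0r.
Qed.

Lemma comp_nonunitsPn x : x \notin comp_nonunits -> exists y, e * x * y = e.
Proof. by rewrite inE negbK => /existsP[y /eqP]; exists y. Qed.

Variable A : Sring R.
Hypotheses (hA : Sring_over A) (hprim : quasiprimitive A).

Lemma inv_eq_local x y : x != 0 -> y != 0 -> inv_eq A x y.
Proof.
apply: (inv_eq_neq0 hA hprim comp_nonunits_add _ comp_nonunits1).
  by rewrite -(mul0r e') comp_nonunits_mul ?comp_nonunits_e'.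
exact: (inv_eq_off hA hprim p_pr idem_e' e_neq0 comp_nonunits_add
  comp_nonunits_mul comp_nonunits1 comp_nonunits_e' comp_nonunits_p
  comp_nonunitsPn).
Qed.

Lemma Srank2_or_cyclotomic : Srank A = 2%N \/ cyclotomic A.
Proof.
(* If [e'] is nonzero, [e] and [e'] split R; if it is 0, R itself is local and [comp_nonunits] is
   its set of nonunits. *)
have [e'0 | e'n0] := eqVneq e' 0; last first.
  left; apply: (Srank2_split hA inv_eq_local _ _ e_neq0 e'n0); first exact: subrK.
  by rewrite mulrC e'_mul_e.
have e1 : e = 1 by rewrite /e e'0 subr0.
have unitE x : (x \is a GRing.unit) = (x \notin comp_nonunits).
  rewrite inE negbK e1; apply/unitrPr/existsP => -[y xy]; exists y.
    by rewrite mul1r xy.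
  by rewrite -[x]mul1r; apply/eqP.
have [/existsP[h /andP[Hh h0]] | /existsPn noH] :=
    boolP [exists h, (h \in comp_nonunits) && (h != 0)].
  left; apply: (Srank2_local hA inv_eq_local comp_nonunits_add comp_nonunits_mul
    comp_nonunits1 unitE).
  by exists h.
right; apply: field_cyclotomic inv_eq_local _ => // x x0; rewrite unitE.
by have := noH x; rewrite x0 andbT.
Qed.

End LocalData.

Theorem theorem1p4 (R : finComUnitRingType)
    (hR : exists2 p : nat, p \in primes #|R| &
            local_ring (primary_component R p))
    (A : Sring R) (hA : Sring_over A) (hprim : quasiprimitive A) :
  (Srank A = 2 \/ cyclotomic A) /\ (cyclotomic A -> GRing.field_axiom R).
Proof.
split; last exact: cyclotomic_field.
have [p] := hR; rewrite mem_primes => /and3P[p_pr _ p_dvd] localR.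
exact: (Srank2_or_cyclotomic p_pr p_dvd localR).
Qed.
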